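(* Let $A=A_0+A_1\epsilon\in\mathbb{DQ}^{m\times n}$, $B=B_0+B_1\epsilon\in\mathbb{DQ}^{m\times k}$, $C=C_0+C_1\epsilon\in\mathbb{DQ}^{k\times l}$ and $D=D_0+D_1\epsilon\in\mathbb{DQ}^{n\times l}$ be given. Set $$ \begin{array}{l} B_{11}=B_1-A_1(A_0^{\dagger}B_0+L_{A_0}D_0C_0^{\dagger}),\quad D_{11}=D_1-(A_0^{\dagger}B_0+L_{A_0}D_0C_0^{\dagger})C_1,\quad A_{11}=A_1L_{A_0},\\ C_{11}=R_{C_0}C_1,\quad A_2=R_{A_0}A_{11},\quad B_2=R_{C_0},\quad C_2=R_{A_0}B_{11},\quad A_3=L_{A_0},\quad B_3=C_{11}L_{C_0},\\ C_3=D_{11}L_{C_0},\quad A_{00}=A_3L_{A_2},\quad B_{00}=R_{B_2}B_3,\quad C_{00}=C_3-A_3A_2^{\dagger}C_2B_2^{\dagger}B_3,\quad D_{00}=R_{A_{00}}A_3,\\ \Phi=A_2^{\dagger}C_2B_2^{\dagger}+L_{A_2}A_{00}^{\dagger}C_{00}B_3^{\dagger}-L_{A_2}A_{00}^{\dagger}A_3 D_{00}^{\dagger}R_{A_{00}}C_{00}B_3^{\dagger}+D_{00}^{\dagger}R_{A_{00}}C_{00}B_{00}^{\dagger}R_{B_2}. \end{array} $$ Then the following statements are equivalent: (1) The system of dual quaternion matrix equations $AX=B$, $XC=D$ is consistent (i.e. has a solution $X\in\mathbb{DQ}^{n\times k}$). (2) All of the following hold: $$R_{A_0}B_0=0,\quad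 D_0L_{C_0}=0,$$ $$A_0D_0=B_0C_0,\quad A_0D_1-B_0C_1=B_1C_0-A_1D_0,$$ $$R_{A_2}C_2=0,\quad C_2L_{B_2}=0,\quad R_{A_3}C_3=0,\quad C_3L_{B_3}=0,\quad R_{A_{00}}C_{00}L_{B_{00}}=0.$$ (3) $A_0D_0=B_0C_0$ and $A_0D_1-B_0C_1=B_1C_0-A_1D_0$ hold, together with the rank equalities $$r\begin{bmatrix}A_0&B_0\end{bmatrix}=r(A_0),\qquad r\begin{bmatrix}C_0 \\ D_0\end{bmatrix}=r(C_0),$$ $$r\begin{bmatrix}A_0&B_1&A_1 \\ 0&B_0&A_0\end{bmatrix}=r\begin{bmatrix}A_0&A_1 \\ 0&A_0\end{bmatrix},\qquad r\begin{bmatrix}A_0&A_1D_0-B_1C_0\end{bmatrix}=r(A_0),$$ $$r\begin{bmatrix}C_0 \\ B_0C_1-A_0D_1\end{bmatrix}=r(C_0),\qquad r\begin{bmatrix}C_0&0 \\ D_1&D_0 \\ C_1&C_0\end{bmatrix}=r\begin{bmatrix}C_0&0 \\ C_1&C_0\end{bmatrix},$$ $$r\begin{bmatrix}B_1C_1-A_1D_1&A_0&B_1C_0-A_1D_0 \\ C_0&0&0 \\ B_0C_1-A_0D_1&0&0\end{bmatrix}=r(A_0)+r(C_0).$$ In this case, the general solution of the system $AX=B$, $XC=D$ can be expressed as $X=X_0+X_1\epsilon$, where $$X_0=A_0^{\dagger}B_0+L_{A_0}D_0C_0^{\dagger}+L_{A_0}UR_{C_0},$$ $$X_1=A_0^{\dagger}(B_{11}-A_{11}UR_{C_0})+L_{A_0}(D_{11}-L_{A_0}UC_{11})C_0^{\dagger}+L_{A_0}U_1R_{C_0},$$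 $$U=\Phi+L_{A_2}L_{A_{00}}U_2+U_3R_{B_{00}}R_{B_2}+L_{A_2}U_4R_{B_3}+L_{A_3}U_5R_{B_2},$$ and $U_1,U_2,U_3,U_4,U_5$ are arbitrary matrices over $\mathbb{H}$ of appropriate sizes.
   Context: $\mathbb{H}$ denotes the real quaternions. The dual quaternions are $\mathbb{DQ}=\{c_0+c_1\epsilon: c_0,c_1\in\mathbb{H}\}$, where $\epsilon^2=0$ and $\epsilon$ commutes with quaternions; addition and multiplication are the resulting ones, e.g. $(a_0+a_1\epsilon)(b_0+b_1\epsilon)=a_0b_0+(a_0b_1+a_1b_0)\epsilon$. A dual quaternion matrix $A\in\mathbb{DQ}^{m\times n}$ is written uniquely as $A=A_0+A_1\epsilon$ with $A_0,A_1\in\mathbb{H}^{m\times n}$, and two such matrices are equal iff their two parts are equal. For a quaternion matrix $M\in\mathbb{H}^{m\times n}$: $r(M)$ is its rank; $M^*$ its conjugate transpose; $M^\dagger$ its Moore-Penrose inverse, i.e. the unique $X$ with $MXM=M$, $XMX=X$, $(MX)^*=MX$, $(XM)^*=XM$; and $L_M=I-M^\dagger M$, $R_M=I-MM^\dagger$. ''The general solution can be expressed as'' means that the solutions are exactly the matrices given by the formula as the arbitrary parameter matrices vary. *)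

(* Defs.v *)
From HB Require Import structures.
From mathcomp Require Import all_boot all_order all_algebra.
From mathcomp Require Import ring.
From mathcomp Require Import boolp classical_sets reals.

Set Implicit Arguments.
Unset Strict Implicit.
Unset Printing Implicit Defensive.

Import GRing.Theory.
Local Open Scope ring_scope.

Declare Scope quat_scope.
Delimit Scope quat_scope with quat.

(* [Quat a b c d] is a + b i + c j + d k.  The ring structure only needs
   commutative coefficients; the real quaternions are the case R : realType. *)
Record quat (R : Type) := Quat { qre : R; qim_i : R; qim_j : R; qim_k : R }.

Section QuatRing.
Variable R : comNzRingType.
Local Notation Q := (quat R).
Implicit Types p q r : Q.

Definition quat_tuple q := (qre q, qim_i q, qim_j q, qim_k q).
Definition tuple_quat (t : R * R * R * R) : Q :=
  Quat t.1.1.1 t.1.1.2 t.1.2 t.2.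
Lemma quat_tupleK : cancel quat_tuple tuple_quat. Proof. by case. Qed.

HB.instance Definition _ := Choice.copy Q (can_type quat_tupleK).

Definition addq p q := Quat (qre p + qre q) (qim_i p + qim_i q)
                            (qim_j p + qim_j q) (qim_k p + qim_k q).
Definition oppq p := Quat (- qre p) (- qim_i p) (- qim_j p) (- qim_k p).
Definition mulq p q :=
  let: Quat a b c d := p in
  let: Quat a' b' c' d' := q in
  Quat (a * a' - b * b' - c * c' - d * d')
       (a * b' + b * a' + c * d' - d * c')
       (a * c' - b * d' + c * a' + d * b')
       (a * d' + b * c' - c * b' + d * a').

Lemma addqA : associative addq.
Proof. by move=> p q r; rewrite /addq /= !addrA. Qed.
Lemma addqC : commutative addq.
Proof. by move=> p q; congr Quat; rewrite addrC. Qed.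
Lemma add0q : left_id (Quat 0 0 0 0) addq.
Proof. by case=> a b c d; rewrite /addq /= !add0r. Qed.
Lemma addNq : left_inverse (Quat 0 0 0 0) oppq addq.
Proof. by move=> p; rewrite /addq /= !addNr. Qed.

HB.instance Definition _ := GRing.isZmodule.Build Q addqA addqC add0q addNq.

Lemma mulqA : associative mulq.
Proof. by case=> ? ? ? ? [? ? ? ?] [? ? ? ?]; congr Quat; ring. Qed.
Lemma mul1q : left_id (Quat 1 0 0 0) mulq.
Proof. by case=> ? ? ? ?; congr Quat; ring. Qed.
Lemma mulq1 : right_id (Quat 1 0 0 0) mulq.
Proof. by case=> ? ? ? ?; congr Quat; ring. Qed.
Lemma mulqDl : left_distributive mulq addq.
Proof. by case=> ? ? ? ? [? ? ? ?] [? ? ? ?]; congr Quat => /=; ring. Qed.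
Lemma mulqDr : right_distributive mulq addq.
Proof. by case=> ? ? ? ? [? ? ? ?] [? ? ? ?]; congr Quat => /=; ring. Qed.
Lemma oneq_neq0 : Quat 1 0 0 0 != 0 :> Q.
Proof. by apply/eqP => -[] /eqP; rewrite oner_eq0. Qed.

HB.instance Definition _ :=
  GRing.Zmodule_isNzRing.Build Q mulqA mul1q mulq1 mulqDl mulqDr oneq_neq0.

Definition conjq q := Quat (qre q) (- qim_i q) (- qim_j q) (- qim_k q).

End QuatRing.

(* [Dual a b] is a + b eps with eps ^ 2 = 0 and eps central. *)
Record dual (T : Type) := Dual { dstd : T; dinf : T }.

Section DualRing.
Variable T : nzRingType.
Local Notation D := (dual T).
Implicit Types x y z : D.

Definition dual_pair x := (dstd x, dinf x).
Definition pair_dual (t : T * T) : D := Dual t.1 t.2.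
Lemma dual_pairK : cancel dual_pair pair_dual. Proof. by case. Qed.

HB.instance Definition _ := Choice.copy D (can_type dual_pairK).

Definition addd x y := Dual (dstd x + dstd y) (dinf x + dinf y).
Definition oppd x := Dual (- dstd x) (- dinf x).
Definition muld x y :=
  Dual (dstd x * dstd y) (dstd x * dinf y + dinf x * dstd y).

Lemma adddA : associative addd.
Proof. by move=> x y z; rewrite /addd /= !addrA. Qed.
Lemma adddC : commutative addd.
Proof. by move=> x y; congr Dual; rewrite addrC. Qed.
Lemma add0d : left_id (Dual 0 0) addd.
Proof. by case=> a b; rewrite /addd /= !add0r. Qed.
Lemma addNd : left_inverse (Dual 0 0) oppd addd.
Proof. by move=> x; rewrite /addd /= !addNr. Qed.

HB.instance Definition _ := GRing.isZmodule.Build D adddA adddC add0d addNd.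

Lemma muldA : associative muld.
Proof.
by move=> x y z; congr Dual; rewrite /= ?mulrDl ?mulrDr !mulrA ?addrA.
Qed.
Lemma mul1d : left_id (Dual 1 0) muld.
Proof. by case=> a b; rewrite /muld /= !mul1r mul0r addr0. Qed.
Lemma muld1 : right_id (Dual 1 0) muld.
Proof. by case=> a b; rewrite /muld /= !mulr1 mulr0 add0r. Qed.
Lemma muldDl : left_distributive muld addd.
Proof.
by move=> x y z; congr Dual; rewrite /= !mulrDl // addrACA.
Qed.
Lemma muldDr : right_distributive muld addd.
Proof.
by move=> x y z; congr Dual; rewrite /= !mulrDr // addrACA.
Qed.
Lemma oned_neq0 : Dual 1 0 != 0 :> D.
Proof. by apply/eqP => -[] /eqP; rewrite oner_eq0. Qed.

HB.instance Definition _ :=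
  GRing.Zmodule_isNzRing.Build D muldA mul1d muld1 muldDl muldDr oned_neq0.

End DualRing.

Section DualMatrix.
Variables (T : nzRingType) (m n : nat).

(* A = A_0 + A_1 eps, with A_0 = [stdmx A] and A_1 = [infmx A]. *)
Definition stdmx (A : 'M[dual T]_(m, n)) : 'M[T]_(m, n) := map_mx (@dstd T) A.
Definition infmx (A : 'M[dual T]_(m, n)) : 'M[T]_(m, n) := map_mx (@dinf T) A.
Definition dualmx (A0 A1 : 'M[T]_(m, n)) : 'M[dual T]_(m, n) :=
  \matrix_(i, j) Dual (A0 i j) (A1 i j).

Lemma dualmxE A : dualmx (stdmx A) (infmx A) = A.
Proof. by apply/matrixP => i j; rewrite !mxE; case: (A i j). Qed.
Lemma stdmx_dualmx A0 A1 : stdmx (dualmx A0 A1) = A0.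
Proof. by apply/matrixP => i j; rewrite !mxE. Qed.
Lemma infmx_dualmx A0 A1 : infmx (dualmx A0 A1) = A1.
Proof. by apply/matrixP => i j; rewrite !mxE. Qed.

End DualMatrix.

Section QuatMatrix.
Variable R : realType.
Local Notation H := (quat R).

Definition ctrmx m n (M : 'M[H]_(m, n)) : 'M[H]_(n, m) :=
  map_mx (@conjq R) M^T.

(* The scalars multiply on the right: (M *m v) i 0 = \sum_j M i j * v j 0. *)
Definition cols_right_free m n (M : 'M[H]_(m, n)) (S : {set 'I_n}) : Prop :=
  forall v : 'cV[H]_n,
    (forall j, j \notin S -> v j 0 = 0) -> M *m v = 0 -> v = 0.

(* Mathcomp's \rank requires commutative coefficients, so the rank is the
   maximal number of right linearly independent columns. *)
Definition qrank m n (M : 'M[H]_(m, n)) : nat :=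
  \max_(S : {set 'I_n} | `[< cols_right_free M S >]) #|S|.

Definition is_mpinv m n (M : 'M[H]_(m, n)) (X : 'M[H]_(n, m)) : Prop :=
  [/\ M *m X *m M = M, X *m M *m X = X,
      ctrmx (M *m X) = M *m X & ctrmx (X *m M) = X *m M].

Lemma conjqD : {morph @conjq R : p q / p + q}.
Proof. by move=> p q; congr Quat; rewrite /= ?opprD. Qed.

Lemma conjq0 : conjq (0 : H) = 0.
Proof. by congr Quat; rewrite /= ?oppr0. Qed.

Lemma conjqM (p q : H) : conjq (p * q) = conjq q * conjq p.
Proof. by case: p q => ? ? ? ? [? ? ? ?]; congr Quat => /=; ring. Qed.

Lemma ctrmx_mul m n p (M : 'M[H]_(m, n)) (N : 'M[H]_(n, p)) :
  ctrmx (M *m N) = ctrmx N *m ctrmx M.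
Proof.
apply/matrixP => i j; rewrite !mxE (big_morph _ conjqD conjq0).
by apply: eq_bigr => k _; rewrite !mxE conjqM.
Qed.

Lemma is_mpinv_uniq m n (M : 'M[H]_(m, n)) X Y :
  is_mpinv M X -> is_mpinv M Y -> X = Y.
Proof.
move=> [X1 X2 X3 X4] [Y1 Y2 Y3 Y4].
have eL : M *m X = M *m Y.
  rewrite -{1}Y1 -!mulmxA mulmxA -{1}Y3 -{1}X3 -ctrmx_mul.
  by rewrite mulmxA X1 Y3.
have eR : X *m M = Y *m M.
  rewrite -{1}Y1 !mulmxA -(mulmxA (X *m M)) -{1}Y4 -{1}X4 -ctrmx_mul.
  by rewrite -!mulmxA (mulmxA M) X1 Y4.
by rewrite -X2 eR -mulmxA eL mulmxA Y2.
Qed.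

(* The unique X such that [is_mpinv M X]; the default value 0 is never used,
   as every quaternion matrix has a Moore-Penrose inverse. *)
Definition mpinv m n (M : 'M[H]_(m, n)) : 'M[H]_(n, m) :=
  xget 0 [set X | is_mpinv M X]%classic.

Lemma mpinvE m n (M : 'M[H]_(m, n)) X : is_mpinv M X -> mpinv M = X.
Proof.
by move=> MX; apply: xget_unique => // Y MY; exact: is_mpinv_uniq MY MX.
Qed.

Definition Lmx m n (M : 'M[H]_(m, n)) : 'M[H]_n := 1%:M - mpinv M *m M.
Definition Rmx m n (M : 'M[H]_(m, n)) : 'M[H]_m := 1%:M - M *m mpinv M.

End QuatMatrix.

(* Main.v *)
Require Import Defs.
From HB Require Import structures.
From mathcomp Require Import all_boot all_order all_algebra.
From mathcomp Require Import boolp classical_sets reals.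
From mathcomp Require Import ring lra.

Import GRing.Theory Num.Theory.
Local Open Scope ring_scope.

(** Write X = X0 + X1 eps.  The equations A X = B, X C = D say that
      A0 X0 = B0,  X0 C0 = D0,    and
      A0 X1 = B1 - A1 X0,  X1 C0 = D1 - X0 C1:
    two systems of the same shape over the quaternions.  Such a system has a
    solution iff each equation has one and A D = B C, and then one matrix is
    free ([eq_pairP]).  Let V be the free matrix of X0.  For the second system,
    A D = B C becomes a condition on the data alone, while the solvability of
    its two equations becomes A2 V B2 = C2 and A3 V B3 = C3.  As B2 = R_{C0} and
    B3 = R_{C0} C1 L_{C0}, the column space of B3 lies in that of B2, that is
    B00 = R_{B2} B3 = 0, and two such equations are solved by first determining
    A2 V B2 and then correcting V by a term in L_{A2} ([eq_two_sidedP]).  This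
    gives (1) <-> (2) and the general solution.

    For (3), every rank equality is the existence of a factorization.  If
    deleting columns (rows) of T keeps its rank, then T is a right (left)
    multiple of what remains ([qrank_colsP], [qrank_rowsP]); and the rank of
    [M A; C 0] is r(A) + r(C) iff M = A P + Q C ([qrank_block0P]).  The two
    rank equalities with triangular blocks then say that A X = B and X C = D are
    separately solvable over the dual quaternions, and the last one says that
    R_{A0} (B1 C1 - A1 D1) L_{C0} = 0.  Given the others, this is
    A2 C3 = C2 B3, which turns C00 into A00 C3 and so gives R_{A00} C00 = 0.

    The facts on ranks rest on Gaussian elimination over a division ring: a
    matrix with more columns than rows has a nonzero kernel vector
    ([wide_mx_ker]).  Hence [qrank M] is at once the least inner dimension of a
    factorization of M and the largest number of columns of a P with M P
    injective ([qrank_leq], [leq_qrank]).  The factorization of least inner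
    dimension also yields the Moore-Penrose inverse ([ex_mpinv]). *)

Section LinearAlgebra.
Set Implicit Arguments.
Unset Strict Implicit.
Variable R : realType.
Local Notation H := (quat R).

(** * Linear systems over the quaternions *)

(** The inverse is the conjugate divided by the squared norm. *)
Lemma quat_inv (q : H) : q != 0 -> exists p, q * p = 1.
Proof.
case: q => a b c d q0.
pose N := a ^+ 2 + b ^+ 2 + c ^+ 2 + d ^+ 2.
have N0 : N != 0.
  apply: contra q0 => /eqP N0; rewrite /N in N0.
  have [a0 b0 c0 d0] : [/\ a = 0, b = 0, c = 0 & d = 0] by split; nra.
  by rewrite a0 b0 c0 d0.
exists (Quat (a / N) (- b / N) (- c / N) (- d / N)).
by congr Quat; rewrite /N; field.
Qed.

Lemma qre_sum (I : finType) (F : I -> H) : qre (\sum_i F i) = \sum_i qre (F i).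
Proof. exact: (big_morph (@qre R)). Qed.

(** Scalars act on the right, so the linear maps are the left multiplications
    v |-> M v on column vectors. *)
Definition mx_inj m n (M : 'M[H]_(m, n)) : Prop :=
  forall v : 'cV[H]_n, M *m v = 0 -> v = 0.

Lemma mx_inj0 m n p (M : 'M[H]_(m, n)) (Y : 'M_(n, p)) :
  mx_inj M -> M *m Y = 0 -> Y = 0.
Proof.
move=> iM MY; apply/matrixP => i j.
have /iM/matrixP/(_ i 0) : M *m col j Y = 0 by rewrite colE mulmxA MY mul0mx.
by rewrite !mxE.
Qed.

Lemma mx_injI m n p (M : 'M[H]_(m, n)) (Y Z : 'M_(n, p)) :
  mx_inj M -> M *m Y = M *m Z -> Y = Z.
Proof.
move=> iM MYZ; apply/eqP; rewrite -subr_eq0; apply/eqP.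
by apply: (mx_inj0 iM); rewrite mulmxBr MYZ subrr.
Qed.

Lemma mx11_inv (c : 'M[H]_1) : c != 0 -> exists d : 'M_1, c *m d = 1%:M.
Proof.
move=> c0; have /quat_inv [p cp] : c 0 0 != 0.
  by apply: contra c0 => /eqP c0; apply/eqP/matrixP => i j; rewrite !ord1 c0 mxE.
exists (const_mx p); apply/matrixP => i j.
by rewrite !ord1 !mxE big_ord1 mxE cp.
Qed.

(** Elimination of one row: if the first row is nonzero, its kernel is the image
    of an injective matrix K with one column less, and the induction hypothesis
    applies to the remaining rows of M K. *)
Lemma wide_mx_ker r s (M : 'M[H]_(r, s)) :
  (r < s)%N -> exists2 v : 'cV_s, v != 0 & M *m v = 0.
Proof.
elim: r s M => [|r IHr] [|s] // M rs.
  exists (const_mx 1); last by apply/matrixP => -[].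
  by apply/eqP => /matrixP/(_ 0 0); rewrite !mxE => /eqP; rewrite oner_eq0.
have [j M0j|M0] := pickP (fun j => M 0 j != 0); last first.
  have [v v0 Mv] := IHr _ (row' 0 M) (ltnW rs).
  exists v => //; apply/matrixP => i k.
  case: (unliftP 0 i) => [i'|] ->{i}.
    move/matrixP/(_ i' k): Mv; rewrite !mxE => Mv.
    by rewrite -[RHS]Mv; apply: eq_bigr => ? _; rewrite mxE.
  by rewrite !mxE big1 // => t _; move/negbFE/eqP: (M0 t) ->; rewrite mul0r.
have [p M0p] := quat_inv M0j.
(* Column t of K is the kernel vector of the first row that has 1 at the
   position lift j t and is zero outside j and lift j t. *)
pose K : 'M[H]_(s.+1, s) :=
  \matrix_(i, t) if unlift j i is Some i' then (i' == t)%:R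
                 else - p * M 0 (lift j t).
have [w w0 MKw] := IHr _ (row' 0 (M *m K)) rs.
have Kw t : (K *m w) (lift j t) 0 = w t 0.
  rewrite mxE (bigD1 t) //= mxE liftK eqxx mul1r big1 ?addr0 // => u ut.
  by rewrite mxE liftK eq_sym (negPf ut) mul0r.
exists (K *m w).
  apply: contra w0 => /eqP Kw0; apply/eqP/matrixP => t u.
  by rewrite ord1 -Kw Kw0 !mxE.
apply/matrixP => i k; rewrite mulmxA.
case: (unliftP 0 i) => [i'|] ->{i}.
  move/matrixP/(_ i' k): MKw; rewrite !mxE => MKw.
  by rewrite -[RHS]MKw; apply: eq_bigr => ? _; congr (_ * _); rewrite !mxE.
rewrite !mxE big1 // => t _; rewrite mxE (bigD1_ord j) //= mxE unlift_none.
rewrite mulrA mulrN M0p mulN1r (bigD1 t) //= mxE liftK eqxx mulr1.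
rewrite big1 ?addr0 ?addNr ?mul0r // => u ut.
by rewrite mxE liftK (negPf ut) mulr0.
Qed.

(** The wide matrix [P x] has a kernel vector, and its last coordinate cannot
    vanish when P is injective. *)
Lemma mx_inj_solve r (P : 'M[H]_r) (x : 'cV_r) :
  mx_inj P -> exists y, x = P *m y.
Proof.
move=> iP; have r_lt : (r < r + 1)%N by rewrite addn1.
have [v v0] := wide_mx_ker (row_mx P x) r_lt.
rewrite -[v]vsubmxK mul_row_col => Pv.
have [c0|/mx11_inv [d cd]] := eqVneq (dsubmx v) 0.
  move: Pv v0; rewrite c0 mulmx0 addr0 => /iP u0.
  by rewrite -[v]vsubmxK c0 u0 col_mx0 eqxx.
exists (- (usubmx v *m d)); rewrite mulmxN mulmxA.
have /eqP -> : P *m usubmx v == - (x *m dsubmx v) by rewrite -addr_eq0 Pv.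
by rewrite mulNmx opprK -mulmxA cd mulmx1.
Qed.

Lemma mx_inj_inv r (P : 'M[H]_r) :
  mx_inj P -> exists2 Y, P *m Y = 1%:M & Y *m P = 1%:M.
Proof.
move=> iP.
have [f fP] := choice (fun j : 'I_r => mx_inj_solve (col j 1%:M) iP).
pose Y : 'M_r := \matrix_(i, j) f j i 0.
have PY : P *m Y = 1%:M.
  apply/matrixP => i j; move/matrixP/(_ i 0): (fP j); rewrite !mxE => ->.
  by apply: eq_bigr => t _; rewrite mxE.
exists Y => //; apply: (mx_injI iP); by rewrite mulmxA PY mul1mx mulmx1.
Qed.

(** * The rank as an inner dimension *)

(** The vectors supported on S are those of the form [selmx S *m w]. *)
Definition selmx n (S : {set 'I_n}) : 'M[H]_(n, #|S|) :=
  \matrix_(i, t) (i == enum_val t)%:R.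

Lemma selmxK n (S : {set 'I_n}) : (selmx S)^T *m selmx S = 1%:M.
Proof.
apply/matrixP => s t; rewrite !mxE (bigD1 (enum_val s)) //= !mxE eqxx mul1r.
rewrite (inj_eq enum_val_inj) big1 ?addr0 // => i /negPf it.
by rewrite !mxE it mul0r.
Qed.

Lemma selmx_out n (S : {set 'I_n}) (w : 'cV[H]_#|S|) j :
  j \notin S -> (selmx S *m w) j 0 = 0.
Proof.
move=> jS; rewrite mxE big1 // => t _; rewrite mxE.
by case: eqP => [jt|]; rewrite ?mul0r //; move: jS; rewrite jt enum_valP.
Qed.

Lemma selmx_supp n (S : {set 'I_n}) (v : 'cV[H]_n) :
  (forall j, j \notin S -> v j 0 = 0) -> v = selmx S *m ((selmx S)^T *m v).
Proof.
move=> vS; apply/matrixP => i j; rewrite ord1.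
have [iS|iS] := boolP (i \in S); last by rewrite selmx_out // vS.
have E t : ((selmx S)^T *m v) t 0 = v (enum_val t) 0.
  rewrite mxE (bigD1 (enum_val t)) //= !mxE eqxx mul1r big1 ?addr0 // => u.
  by move=> /negPf ut; rewrite !mxE ut mul0r.
rewrite mxE (bigD1 (enum_rank_in iS i)) //= E !mxE enum_rankK_in // eqxx mul1r.
rewrite big1 ?addr0 // => t ti; rewrite mxE; case: eqP; last by rewrite mul0r.
by move=> it; case/eqP: ti; apply: enum_val_inj; rewrite enum_rankK_in.
Qed.

(** A maximal family of independent columns, selected by J, spans all columns:
    adding a column outside its span would enlarge the family. *)
Lemma qrank_basis m n (M : 'M[H]_(m, n)) :
  exists (J : 'M_(n, qrank M)) (G : 'M_(qrank M, n)),
    mx_inj (M *m J) /\ M = M *m J *m G.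
Proof.
pose free S := `[< cols_right_free M S >].
have free0 : free finset.set0.
  by apply/asboolP => v v0 _; apply/matrixP => i j; rewrite ord1 mxE v0 ?inE.
have free_gt0 : (0 < #|[pred S | free S]|)%N.
  by apply/card_gt0P; exists finset.set0.
have [S] := eq_bigmax_cond (fun S : {set 'I_n} => #|S|) free_gt0.
rewrite inE => fS rS; have {rS} rS : qrank M = #|S| by rewrite -rS.
have span (j : 'I_n) : exists y, col j M = M *m selmx S *m y.
  (* A dependency w with coordinate 1 at j expresses column j by those in S. *)
  have [w wj Mw] : exists2 w : 'cV[H]_n,
      forall i, i \notin S -> (delta_mx j 0 - w) i 0 = 0 & M *m w = 0.
    have [jS|jS] := boolP (j \in S).
      exists 0; rewrite ?mulmx0 // => i iS; rewrite subr0 mxE.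
      by case: eqP iS => // ->; rewrite jS.
    have /asboolP/existsNP[v /not_implyP[vS /not_implyP[Mv v0]]] : ~~ free (j |: S).
      apply/negP => fjS; have := @leq_bigmax_cond _ free (fun S => #|S|) _ fjS.
      by rewrite -/(qrank M) rS cardsU1 jS ltnn.
    have vj0 : v j 0 != 0.
      apply/eqP => vj0; apply: v0; apply: (fS v) => // i iS.
      have [->//|ij] := eqVneq i j; by apply: vS; rewrite !inE negb_or ij.
    have [p vp] := quat_inv vj0.
    exists (v *m (const_mx p : 'M_1)); last by rewrite mulmxA Mv mul0mx.
    move=> i iS; rewrite !mxE big_ord1 mxE.
    have [->|ij] := eqVneq i j; first by rewrite vp subrr.
    by rewrite vS ?mul0r ?subrr // !inE negb_or ij.
  exists ((selmx S)^T *m (delta_mx j 0 - w)).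
  by rewrite -mulmxA -selmx_supp // colE mulmxBr Mw subr0.
have [f fP] := choice span.
pose G : 'M_(#|S|, n) := \matrix_(i, j) f j i 0.
move: (qrank M) rS => r -> {r}.
exists (selmx S), G; split.
  move=> w; rewrite -mulmxA => Mw; rewrite -[w]mul1mx -selmxK -mulmxA.
  rewrite (fS (_ *m w)); rewrite ?mulmx0 // => j jS; exact: selmx_out.
apply/matrixP => i j; move/matrixP/(_ i 0): (fP j); rewrite mxE => ->.
by rewrite !mxE; apply: eq_bigr => t _; rewrite [G _ _]mxE.
Qed.

(** M P = (M J) (G P) and G P has [qrank M] rows, so a kernel vector of G P is
    forced once P has more columns than that. *)
Lemma leq_qrank m n r (M : 'M[H]_(m, n)) (P : 'M_(n, r)) :
  mx_inj (M *m P) -> (r <= qrank M)%N.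
Proof.
have [J [G [_ eM]]] := qrank_basis M => iMP.
rewrite leqNgt; apply/negP => r_lt; have [v v0 GPv] := wide_mx_ker (G *m P) r_lt.
by case/eqP: v0; apply: iMP; rewrite eM -!mulmxA [G *m _]mulmxA GPv !mulmx0.
Qed.

Lemma qrank_leq m n r (F : 'M[H]_(m, r)) (G : 'M_(r, n)) :
  (qrank (F *m G) <= r)%N.
Proof.
have [J [_ [iJ _]]] := qrank_basis (F *m G).
rewrite leqNgt; apply/negP => r_lt; have [v v0 GJv] := wide_mx_ker (G *m J) r_lt.
by case/eqP: v0; apply: iJ; rewrite -!mulmxA [G *m _]mulmxA GJv mulmx0.
Qed.

Lemma qrank_mul m n p q (P : 'M[H]_(p, m)) (M : 'M_(m, n)) (Q : 'M_(n, q)) :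
  (qrank (P *m M *m Q) <= qrank M)%N.
Proof.
have [J [G [_ eM]]] := qrank_basis M.
by rewrite {1}eM !mulmxA -mulmxA qrank_leq.
Qed.

(** * Existence of the Moore-Penrose inverse *)

Lemma ctrmxK m n : cancel (@ctrmx R m n) (@ctrmx R n m).
Proof.
move=> M; apply/matrixP => i j; rewrite !mxE.
by case: (M i j) => a b c d; rewrite /conjq /= !opprK.
Qed.

Lemma ctrmx1 n : ctrmx (1%:M : 'M[H]_n) = 1%:M.
Proof.
apply/matrixP => i j; rewrite !mxE eq_sym; case: eqP => _; last exact: conjq0.
by congr Quat; rewrite /= oppr0.
Qed.

(** With u' the conjugate transpose of u, the real part of u' u is the sum of the
    squared norms of the entries. *)
Lemma ctrmx_gram_eq0 m (u : 'cV[H]_m) : ctrmx u *m u = 0 -> u = 0.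
Proof.
pose N (q : H) := qre q ^+ 2 + qim_i q ^+ 2 + qim_j q ^+ 2 + qim_k q ^+ 2.
have N_ge0 q : 0 <= N q by rewrite !addr_ge0 ?sqr_ge0.
move=> uu0; have uu : qre ((ctrmx u *m u) 0 0) = 0 by rewrite uu0 mxE.
move: uu; rewrite mxE qre_sum => uu.
have /eqP : \sum_i N (u i 0) = 0.
  rewrite -[RHS]uu; apply: eq_bigr => i _; rewrite !mxE /N.
  by case: (u i 0) => /= *; ring.
rewrite psumr_eq0 // => /allP Nu; apply/matrixP => i j.
rewrite ord1 mxE; have /eqP := Nu i (mem_index_enum i).
rewrite /N; case: (u i 0) => a b c d /= N0.
have [-> -> -> ->] // : [/\ a = 0, b = 0, c = 0 & d = 0] by split; nra.
Qed.

(** F' F is injective because v' F' F v is the squared norm of F v. *)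
Lemma gram_inv m r (F : 'M[H]_(m, r)) : mx_inj F ->
  exists Y : 'M_r, [/\ Y *m (ctrmx F *m F) = 1%:M,
                      ctrmx F *m F *m Y = 1%:M & ctrmx Y = Y].
Proof.
move=> iF.
have /mx_inj_inv[Y FY YF] : mx_inj (ctrmx F *m F).
  move=> v Fv; apply/iF/ctrmx_gram_eq0.
  by rewrite ctrmx_mul -mulmxA (mulmxA (ctrmx F)) Fv mulmx0.
exists Y; split=> //.
have FF : ctrmx (ctrmx F *m F) = ctrmx F *m F by rewrite ctrmx_mul ctrmxK.
by rewrite -[LHS]mulmx1 -FY mulmxA -{1}FF -ctrmx_mul FY ctrmx1 mul1mx.
Qed.

Lemma mx_inj_linv m r (F : 'M[H]_(m, r)) :
  mx_inj F -> exists Z : 'M_(r, m), Z *m F = 1%:M.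
Proof.
move=> /gram_inv[Y [YF _ _]]; exists (Y *m ctrmx F); by rewrite -mulmxA.
Qed.

Lemma linv_mx_inj m r (F : 'M[H]_(m, r)) (Z : 'M_(r, m)) :
  Z *m F = 1%:M -> mx_inj F.
Proof. by move=> ZF v Fv; rewrite -[v]mul1mx -ZF -mulmxA Fv mulmx0. Qed.

(** With M = F G, where F is injective and G surjective, the inverse is the
    classical G' (G G')^-1 (F' F)^-1 F', a prime being the conjugate transpose. *)
Lemma ex_mpinv m n (M : 'M[H]_(m, n)) : exists X, is_mpinv M X.
Proof.
have [J [G []]] := qrank_basis M; move: (qrank M) J G => r J G iF eM.
have GJ : G *m J = 1%:M by apply: (mx_injI iF); rewrite mulmxA -eM mulmx1.
rewrite eM; move: (M *m J) iF => F iF.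
have iG : mx_inj (ctrmx G).
  by apply: (@linv_mx_inj _ _ _ (ctrmx J)); rewrite -ctrmx_mul GJ ctrmx1.
have [Y [YF FY Y_]] := gram_inv iF.
have [Z [ZG GZ Z_]] := gram_inv iG.
move: ZG GZ; rewrite ctrmxK => ZG GZ.
pose X := ctrmx G *m Z *m Y *m ctrmx F.
have MX : F *m G *m X = F *m Y *m ctrmx F.
  by rewrite /X -!mulmxA (mulmxA G) (mulmxA (G *m _)) GZ mul1mx.
have XM : X *m (F *m G) = ctrmx G *m Z *m G.
  by rewrite /X -!mulmxA (mulmxA (ctrmx F)) (mulmxA Y) YF mul1mx.
exists X; split.
- by rewrite MX -!mulmxA (mulmxA (ctrmx F)) (mulmxA Y) YF mul1mx.
- by rewrite XM /X -!mulmxA (mulmxA G) (mulmxA (G *m _)) GZ mul1mx.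
- by rewrite MX !ctrmx_mul ctrmxK Y_ mulmxA.
- by rewrite XM !ctrmx_mul ctrmxK Z_ mulmxA.
Qed.

Lemma mpinvP m n (M : 'M[H]_(m, n)) : is_mpinv M (mpinv M).
Proof. by have [X MX] := ex_mpinv M; rewrite (mpinvE MX). Qed.

Lemma mulmxpK m n (M : 'M[H]_(m, n)) : M *m mpinv M *m M = M.
Proof. by have [] := mpinvP M. Qed.

(** * Rank equalities as factorizations *)

(** With T = T J G, injectivity of T P makes the square matrix G P injective,
    hence invertible, so the columns of T P span all those of T. *)
Lemma qrank_saturated m n r (T : 'M[H]_(m, n)) (P : 'M_(n, r)) :
  r = qrank T -> mx_inj (T *m P) -> exists Y, T = T *m P *m Y.
Proof.
have [J [G [_]]] := qrank_basis T; move: (qrank T) J G => s J G eT rs.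
move: rs P => -> P iTP.
have [Y GPY _] : exists2 Y, G *m P *m Y = 1%:M & Y *m (G *m P) = 1%:M.
  apply: mx_inj_inv => v Gv; apply: iTP.
  by rewrite eT -!mulmxA (mulmxA G) Gv !mulmx0.
exists (Y *m G); rewrite {2}eT -!mulmxA (mulmxA G) (mulmxA _ Y).
by rewrite GPY mul1mx mulmxA.
Qed.

(** For E a selection of columns, this is: T and some of its columns have the
    same rank iff these columns generate the others. *)
Lemma qrank_colsP m n p (T : 'M[H]_(m, n)) (E : 'M_(n, p)) :
  qrank T = qrank (T *m E) <-> exists Y, T = T *m E *m Y.
Proof.
have TE_le : (qrank (T *m E) <= qrank T)%N.
  by have := qrank_mul 1%:M T E; rewrite mul1mx.
split=> [rTE|[Y eT]].
  have [J [_ [iJ _]]] := qrank_basis (T *m E); rewrite -mulmxA in iJ.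
  have [Y eT] := qrank_saturated (esym rTE) iJ.
  by exists (J *m Y); rewrite !mulmxA in eT *.
apply/eqP; rewrite eqn_leq TE_le andbT.
by have := qrank_mul 1%:M (T *m E) Y; rewrite mul1mx -eT.
Qed.

(** The dual of [qrank_colsP].  The rank counts columns, so the argument is not
    symmetric: a J that makes E T J injective makes T J injective as well, and a
    left inverse of E T J recovers T from E T. *)
Lemma qrank_rowsP m n p (T : 'M[H]_(m, n)) (E : 'M_(p, m)) :
  qrank T = qrank (E *m T) <-> exists Y, T = Y *m (E *m T).
Proof.
have ET_le : (qrank (E *m T) <= qrank T)%N.
  by have := qrank_mul E T 1%:M; rewrite mulmx1.
split=> [rET|[Y eT]].
  have [J [_ [iJ _]]] := qrank_basis (E *m T).
  move: (qrank (E *m T)) rET J iJ => r rET J iJ.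
  have [Z ZJ] := mx_inj_linv iJ.
  have [|Y eT] := @qrank_saturated _ _ _ T J (esym rET).
    by apply: (@linv_mx_inj _ _ _ (Z *m E)); rewrite -ZJ !mulmxA.
  exists (T *m J *m Z); rewrite {1}eT -!mulmxA; congr (_ *m (_ *m _)).
  by rewrite !mulmxA in ZJ; rewrite eT !mulmxA ZJ mul1mx.
apply/eqP; rewrite eqn_leq ET_le andbT.
by have := qrank_mul Y (E *m T) 1%:M; rewrite mulmx1 -eT.
Qed.

Lemma qrank_row_mxP m n p (A : 'M[H]_(m, n)) (B : 'M_(m, p)) :
  qrank (row_mx A B) = qrank A <-> exists Y, B = A *m Y.
Proof.
have eA : row_mx A B *m col_mx 1%:M 0 = A.
  by rewrite mul_row_col mulmx1 mulmx0 addr0.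
have := qrank_colsP (row_mx A B) (col_mx 1%:M 0); rewrite eA => ->.
split=> [[Y]|[Y ->]]; last by exists (row_mx 1%:M Y); rewrite mul_mx_row mulmx1.
by rewrite -[Y]hsubmxK mul_mx_row => /eq_row_mx[_ ->]; exists (rsubmx Y).
Qed.

Lemma qrank_col_mxP m n p (C : 'M[H]_(m, n)) (D : 'M_(p, n)) :
  qrank (col_mx C D) = qrank C <-> exists Y, D = Y *m C.
Proof.
have eC : row_mx 1%:M 0 *m col_mx C D = C.
  by rewrite mul_row_col mul1mx mul0mx addr0.
have := qrank_rowsP (col_mx C D) (row_mx 1%:M 0); rewrite eC => ->.
split=> [[Y]|[Y ->]]; last by exists (col_mx 1%:M Y); rewrite mul_col_mx mul1mx.
by rewrite -[Y]vsubmxK mul_col_mx => /eq_col_mx[_ ->]; exists (dsubmx Y).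
Qed.

(** Bases of A and of C always give r(A) + r(C) independent columns.  If the rank
    is no larger, these columns generate the left block column, and the top part
    of that relation is M = A P + Q C, since the bottom part determines the
    coefficients through C. *)
Lemma qrank_block0P m n p q (M : 'M[H]_(m, n)) (A : 'M_(m, p)) (C : 'M_(q, n)) :
  qrank (block_mx M A C 0) = (qrank A + qrank C)%N <->
  exists P Q, M = A *m P + Q *m C.
Proof.
have [JA [GA [iA eA]]] := qrank_basis A.
have [JC [GC [iC eC]]] := qrank_basis C.
move: (qrank A) (qrank C) JA GA JC GC iA eA iC eC => rA rC JA GA JC GC iA eA iC eC.
have eT : block_mx M A C 0 *m block_mx 0 JC JA 0 =
    block_mx (A *m JA) (M *m JC) 0 (C *m JC).
  by rewrite mulmx_block !mulmx0 !mul0mx ?addr0 ?add0r.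
have iT : mx_inj (block_mx M A C 0 *m block_mx 0 JC JA 0).
  move=> v; rewrite eT -[v]vsubmxK mul_block_col mul0mx add0r => /eqP.
  rewrite col_mx_eq0 => /andP[/eqP + /eqP/iC c0].
  by rewrite c0 mulmx0 addr0 => /iA ->; rewrite col_mx0.
split=> [rT|[P [Q eM]]].
  have [Y] := qrank_saturated (esym rT) iT.
  rewrite eT -[Y]submxK mulmx_block !mul0mx !add0r => /eq_block_mx[eM _ eC' _].
  have [Z ZJ] := mx_inj_linv iC.
  have ZC : Z *m C = dlsubmx Y by rewrite eC' mulmxA ZJ mul1mx.
  by exists (JA *m ulsubmx Y), (M *m JC *m Z); rewrite -[_ *m C]mulmxA ZC mulmxA.
apply/eqP; rewrite eqn_leq (leq_qrank iT) andbT.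
have -> : block_mx M A C 0 =
    block_mx (A *m JA) (Q *m C *m JC) 0 (C *m JC) *m block_mx (GA *m P) GA GC 0.
  rewrite mulmx_block !mul0mx !mulmx0 !addr0 !add0r.
  by rewrite !mulmxA -!(mulmxA (Q *m C)) -(mulmxA Q) !(mulmxA C) -eC -eA -eM.
exact: qrank_leq.
Qed.

(** * Matrix equations over the quaternions *)

Lemma mulmx_Lmx m n (A : 'M[H]_(m, n)) : A *m Lmx A = 0.
Proof. by rewrite mulmxBr mulmx1 mulmxA mulmxpK subrr. Qed.

Lemma Rmx_mulmx m n (A : 'M[H]_(m, n)) : Rmx A *m A = 0.
Proof. by rewrite mulmxBl mul1mx mulmxpK subrr. Qed.

Lemma mulmx_LmxK m n p (X : 'M_(p, m)) (A : 'M[H]_(m, n)) : X *m A *m Lmx A = 0.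
Proof. by rewrite -mulmxA mulmx_Lmx mulmx0. Qed.

Lemma Lmx_compl m n (A : 'M[H]_(m, n)) : mpinv A *m A + Lmx A = 1%:M.
Proof. by rewrite addrC subrK. Qed.

Lemma Rmx_compl m n (A : 'M[H]_(m, n)) : A *m mpinv A + Rmx A = 1%:M.
Proof. by rewrite addrC subrK. Qed.

Lemma Rmx_eq0 m n p (A : 'M[H]_(m, n)) (B : 'M_(m, p)) :
  Rmx A *m B = 0 <-> A *m mpinv A *m B = B.
Proof.
split=> [RB|<-]; first by rewrite -[RHS]mul1mx -(Rmx_compl A) mulmxDl RB addr0.
by rewrite !mulmxA Rmx_mulmx !mul0mx.
Qed.

Lemma Lmx_eq0 m n p (C : 'M[H]_(m, n)) (D : 'M_(p, n)) :
  D *m Lmx C = 0 <-> D *m mpinv C *m C = D.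
Proof.
split=> [DL|<-]; last by rewrite -mulmxA mulmx_Lmx mulmx0.
by rewrite -[RHS]mulmx1 -(Lmx_compl C) mulmxDr DL addr0 mulmxA.
Qed.

Lemma Lmx_id m n p (A : 'M[H]_(m, n)) (X : 'M_(n, p)) :
  A *m X = 0 -> Lmx A *m X = X.
Proof. by move=> AX; rewrite mulmxBl mul1mx -mulmxA AX mulmx0 subr0. Qed.

Lemma Rmx_id m n p (C : 'M[H]_(m, n)) (X : 'M_(p, m)) :
  X *m C = 0 -> X *m Rmx C = X.
Proof. by move=> XC; rewrite mulmxBr mulmx1 mulmxA XC mul0mx subr0. Qed.

Lemma LmxE m n (A : 'M[H]_(m, n)) : Lmx A = 1%:M - mpinv A *m A.
Proof. by []. Qed.

Lemma RmxE m n (A : 'M[H]_(m, n)) : Rmx A = 1%:M - A *m mpinv A.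
Proof. by []. Qed.

(** In the formula, A X only sees the first summand; X C sees the first two, and
    A D = B C is what makes them add up to D.  A solution X is recovered from
    its own formula with V = X. *)
Lemma eq_pairP m n k l (A : 'M[H]_(m, n)) (B : 'M_(m, k))
    (C : 'M_(k, l)) (D : 'M_(n, l)) X :
  A *m X = B /\ X *m C = D <->
  [/\ Rmx A *m B = 0, D *m Lmx C = 0 & A *m D = B *m C] /\
  exists V, X = mpinv A *m B + Lmx A *m D *m mpinv C + Lmx A *m V *m Rmx C.
Proof.
split=> [[<- <-]|[[RB DL AD] [V ->]]].
  split; first by rewrite !mulmxA Rmx_mulmx mul0mx -!mulmxA mulmx_Lmx !mulmx0.
  exists X; rewrite -[LHS]mul1mx -(Lmx_compl A) mulmxDl -addrA mulmxA.
  congr (_ + _).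
  by rewrite -[LHS]mulmx1 -(Rmx_compl C) mulmxDr !mulmxA.
have eB := (Rmx_eq0 A B).1 RB; have eD := (Lmx_eq0 C D).1 DL.
move: (Lmx A) (Rmx C) (mulmx_Lmx A) (Lmx_compl A) (Rmx_mulmx C) => L Q AL AL1 QC.
split; first by rewrite !mulmxDr !mulmxA AL !mul0mx !addr0.
rewrite !mulmxDl -(mulmxA _ Q) QC mulmx0 addr0.
by rewrite -!(mulmxA L) eD -mulmxA -AD mulmxA -mulmxDl AL1 mul1mx.
Qed.

(** A2 V B2 = C2 determines V up to L_{A2} W + U3 R_{B2}.  As R_{B2} B3 = 0, the
    term in U3 does not affect the second equation, which becomes
    A00 W B3 = C00, with the usual solvability conditions.  Since B00 = 0, the
    last condition is R_{A00} C00 = 0 and Phi reduces to its first two terms. *)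
Lemma eq_two_sidedP m1 m2 n k l1 l2
    (A2 : 'M[H]_(m1, n)) (B2 : 'M_(k, l1)) (C2 : 'M_(m1, l1))
    (A3 : 'M_(m2, n)) (B3 : 'M_(k, l2)) (C3 : 'M_(m2, l2)) (V : 'M_(n, k)) :
  let A00 := A3 *m Lmx A2 in
  let B00 := Rmx B2 *m B3 in
  let C00 := C3 - A3 *m mpinv A2 *m C2 *m mpinv B2 *m B3 in
  let D00 := Rmx A00 *m A3 in
  let Phi := mpinv A2 *m C2 *m mpinv B2
             + Lmx A2 *m mpinv A00 *m C00 *m mpinv B3
             - Lmx A2 *m mpinv A00 *m A3 *m mpinv D00 *m Rmx A00 *m C00
                 *m mpinv B3
             + mpinv D00 *m Rmx A00 *m C00 *m mpinv B00 *m Rmx B2 in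
  B00 = 0 ->
  A2 *m V *m B2 = C2 /\ A3 *m V *m B3 = C3 <->
  [/\ Rmx A2 *m C2 = 0, C2 *m Lmx B2 = 0, Rmx A3 *m C3 = 0,
      C3 *m Lmx B3 = 0 & Rmx A00 *m C00 *m Lmx B00 = 0] /\
  exists U2 U3 U4 U5, V =
    Phi + Lmx A2 *m Lmx A00 *m U2 + U3 *m Rmx B00 *m Rmx B2
        + Lmx A2 *m U4 *m Rmx B3 + Lmx A3 *m U5 *m Rmx B2.
Proof.
move=> A00 B00 C00 D00 Phi B00_0.
have L00 : Lmx B00 = 1%:M by rewrite LmxE B00_0 mulmx0 subr0.
have R00 : Rmx B00 = 1%:M by rewrite RmxE B00_0 mul0mx subr0.
have B3E : B2 *m mpinv B2 *m B3 = B3 by apply/Rmx_eq0.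
have PhiE : Rmx A00 *m C00 = 0 ->
    Phi = mpinv A2 *m C2 *m mpinv B2 + Lmx A2 *m mpinv A00 *m C00 *m mpinv B3.
  move=> RC; rewrite /Phi -!(mulmxA _ (Rmx A00)) RC !(mulmx0, mul0mx).
  by rewrite subr0 addr0.
rewrite L00 R00 mulmx1.
split=> [[eC2 eC3]|[[RC2 CL2 RC3 CL3 RC00] [U2 [U3 [U4 [U5 ->]]]]]].
  have eC00 : C00 = A00 *m (V *m B3).
    rewrite /C00 -eC3 -eC2 -!mulmxA (mulmxA B2) B3E /A00 LmxE.
    by rewrite !(mulmxA, mulmxBr, mulmxBl) mulmx1.
  have RC00 : Rmx A00 *m C00 = 0 by rewrite eC00 mulmxA Rmx_mulmx mul0mx.
  split.
    rewrite RC00 -eC2 -eC3; split=> //.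
    - by rewrite !mulmxA Rmx_mulmx !mul0mx.
    - by rewrite mulmx_LmxK.
    - by rewrite !mulmxA Rmx_mulmx !mul0mx.
    - by rewrite mulmx_LmxK.
  (* U5 = 0 suffices: as R_{B00} = 1, the matrices L_{A3} U5 R_{B2} are among the
     U3 R_{B00} R_{B2}. *)
  exists (V *m B3 *m mpinv B3), (mpinv A2 *m A2 *m V), V, 0.
  (* The terms in U2 and U4 complete the second term of Phi to L_{A2} V, that in U3
     completes the first one to A2^+ A2 V, and these two add up to V. *)
  rewrite PhiE // eC00 -eC2 mulmx0 mul0mx addr0 mulmx1.
  have eL : Lmx A2 *m V = Lmx A2 *m mpinv A00 *m (A00 *m (V *m B3)) *m mpinv B3
      + Lmx A2 *m Lmx A00 *m (V *m B3 *m mpinv B3) + Lmx A2 *m V *m Rmx B3.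
    rewrite -!(mulmxA (Lmx A2)) -mulmxDr -mulmxDr; congr (_ *m _).
    rewrite -[LHS]mulmx1 -(Rmx_compl B3) mulmxDr; congr (_ + _).
    by rewrite -[LHS]mul1mx -(Lmx_compl A00) mulmxDl !mulmxA.
  have eP : mpinv A2 *m A2 *m V = mpinv A2 *m (A2 *m V *m B2) *m mpinv B2
      + mpinv A2 *m A2 *m V *m Rmx B2.
    by rewrite -[LHS]mulmx1 -(Rmx_compl B2) mulmxDr !mulmxA.
  rewrite -[LHS]mul1mx -(Lmx_compl A2) mulmxDl {1}eP {1}eL.
  by rewrite -!addrA; congr (_ + _); rewrite addrCA; congr (_ + _); rewrite addrCA.
have {}RC00 : Rmx A00 *m C00 = 0 by [].
have {RC2} eC2 := (Rmx_eq0 _ _).1 RC2; have {}CL2 := (Lmx_eq0 _ _).1 CL2.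
have eC00 : A00 *m mpinv A00 *m C00 = C00 by apply/Rmx_eq0.
have CL00 : C00 *m mpinv B3 *m B3 = C00.
  by apply/Lmx_eq0; rewrite mulmxBl CL3 mulmx_LmxK subrr.
have C00E : A3 *m mpinv A2 *m C2 *m mpinv B2 *m B3 + C00 = C3.
  by rewrite addrC subrK.
have A00E : A3 *m Lmx A2 = A00 by [].
rewrite {}PhiE // {R00 L00 Phi D00 RC00}.
move: (mulmx_Lmx A2) (mulmx_Lmx A3) (mulmx_Lmx A00) (Rmx_mulmx B2) (Rmx_mulmx B3).
rewrite /B00 in B00_0; move: A00E C00E eC00 CL00 B00_0.
clearbody A00 C00.
move: (Lmx A2) (Lmx A3) (Lmx A00) (Rmx B2) (Rmx B3) => L2 L3 L00 Q2 Q3.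
move=> A00E C00E eC00 CL00 Q2B3 A2L A3L A00L Q2B2 Q3B3.
rewrite !mulmxDr !mulmxDl !mulmxA eC2 CL2 A00E eC00 CL00 C00E A2L A3L A00L.
rewrite -!(mulmxA _ Q2) -!(mulmxA _ Q3) Q2B2 Q2B3 Q3B3.
by rewrite !(mulmx0, mul0mx, addr0).
Qed.

(** * Dual matrices and their block ranks *)

Lemma dual_eqP (T : nzRingType) m n (X Y : 'M[dual T]_(m, n)) :
  X = Y <-> stdmx X = stdmx Y /\ infmx X = infmx Y.
Proof. by split=> [->//|[X0 X1]]; rewrite -[X]dualmxE -[Y]dualmxE X0 X1. Qed.

Lemma dual_mulmxP (T : nzRingType) m n p (A : 'M[dual T]_(m, n))
    (X : 'M_(n, p)) (B : 'M_(m, p)) :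
  A *m X = B <-> stdmx A *m stdmx X = stdmx B /\
                 stdmx A *m infmx X + infmx A *m stdmx X = infmx B.
Proof.
suff [S I] : stdmx (A *m X) = stdmx A *m stdmx X /\
    infmx (A *m X) = stdmx A *m infmx X + infmx A *m stdmx X.
  by rewrite -S -I; exact: dual_eqP.
split; apply/matrixP => i j; rewrite !mxE.
  rewrite (big_morph (@dstd T) (id1 := 0) (op1 := +%R)) //.
  by apply: eq_bigr => t _; rewrite !mxE.
rewrite (big_morph (@dinf T) (id1 := 0) (op1 := +%R)) // -big_split.
by apply: eq_bigr => t _; rewrite !mxE.
Qed.

(** The block columns of A0 + A1 eps acting on pairs (X1, X0): the missing columns
    B1, B0 are generated by the others iff the dual equation has a solution. *)
Lemma qrank_dual_colsP m n k (A0 A1 : 'M[H]_(m, n)) (B0 B1 : 'M_(m, k)) :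
  qrank (col_mx (row_mx A0 (row_mx B1 A1)) (row_mx 0 (row_mx B0 A0)))
    = qrank (block_mx A0 A1 0 A0) <->
  exists X0 X1, A0 *m X0 = B0 /\ A0 *m X1 + A1 *m X0 = B1.
Proof.
rewrite -block_mxEv; set T := block_mx A0 _ _ _.
have TE : T *m block_mx 1%:M 0 0 (col_mx 0 1%:M) = block_mx A0 A1 0 A0.
  by rewrite mulmx_block !mul_row_col !(mulmx0, mul0mx, mulmx1, addr0, add0r).
rewrite -TE; apply: iff_trans (qrank_colsP _ _) _; rewrite {}TE {}/T.
split=> [[Y]|[X0 [X1 [<- <-]]]].
  rewrite -[Y]submxK -[ursubmx Y]hsubmxK -[drsubmx Y]hsubmxK mulmx_block.
  rewrite !mul_mx_row mul0mx !add_row_mx.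
  move=> /eq_block_mx[_ /eq_row_mx[-> _] _ /eq_row_mx[-> _]].
  by exists (lsubmx (drsubmx Y)), (lsubmx (ursubmx Y)); rewrite mul0mx add0r.
exists (block_mx 1%:M (row_mx X1 0) 0 (row_mx X0 1%:M)).
rewrite mulmx_block !mul_mx_row !add_row_mx.
by rewrite !(mulmx0, mul0mx, mulmx1, addr0, add0r).
Qed.

Lemma qrank_dual_rowsP n k l (C0 C1 : 'M[H]_(k, l)) (D0 D1 : 'M_(n, l)) :
  qrank (col_mx (row_mx C0 0) (col_mx (row_mx D1 D0) (row_mx C1 C0)))
    = qrank (block_mx C0 0 C1 C0) <->
  exists X0 X1, X0 *m C0 = D0 /\ X0 *m C1 + X1 *m C0 = D1.
Proof.
have -> : col_mx (row_mx C0 0) (col_mx (row_mx D1 D0) (row_mx C1 C0)) =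
    block_mx C0 0 (col_mx D1 C1) (col_mx D0 C0).
  by rewrite -block_mxEv block_mxEh block_mxEv.
set T := block_mx C0 0 (col_mx D1 C1) _.
have TE : block_mx 1%:M 0 0 (row_mx 0 1%:M) *m T = block_mx C0 0 C1 C0.
  by rewrite mulmx_block !mul_row_col !(mulmx0, mul0mx, mul1mx, addr0, add0r).
rewrite -TE; apply: iff_trans (qrank_rowsP _ _) _; rewrite {}TE {}/T.
split=> [[Y]|[X0 [X1 [<- <-]]]].
  rewrite -[Y]submxK -[dlsubmx Y]vsubmxK -[drsubmx Y]vsubmxK mulmx_block.
  rewrite !mul_col_mx mulmx0 !add_col_mx.
  move=> /eq_block_mx[_ _ /eq_col_mx[-> _] /eq_col_mx[-> _]].
  by exists (usubmx (drsubmx Y)), (usubmx (dlsubmx Y)); rewrite mulmx0 add0r addrC.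
exists (block_mx 1%:M 0 (col_mx X1 0) (col_mx X0 1%:M)).
rewrite mulmx_block !mul_col_mx !add_col_mx.
by rewrite !(mulmx0, mul0mx, mul1mx, addr0, add0r) addrC.
Qed.

(** N and K enlarge A and C without changing their ranks, so they are multiples
    of A and C and can be absorbed in P and Q. *)
Lemma qrank_corner0P m n k l q (M : 'M[H]_(m, l)) (A : 'M_(m, n)) (N : 'M_(m, k))
    (C : 'M_(q, l)) (K : 'M_(m, l)) :
  qrank (row_mx A N) = qrank A -> qrank (col_mx C K) = qrank C ->
  qrank (col_mx (row_mx M (row_mx A N))
          (col_mx (row_mx C (row_mx 0 0)) (row_mx K (row_mx 0 0))))
    = (qrank A + qrank C)%N <-> exists P Q, M = A *m P + Q *m C.
Proof.
move=> rA rC.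
have -> : col_mx (row_mx C (row_mx (0 : 'M_(q, n)) (0 : 'M_(q, k))))
                 (row_mx K (row_mx (0 : 'M_(m, n)) (0 : 'M_(m, k)))) =
          row_mx (col_mx C K) 0.
  by rewrite !row_mx0 -block_mxEv block_mxEh col_mx0.
rewrite -block_mxEv -rA -rC; apply: iff_trans (qrank_block0P _ _ _) _.
split=> [[P [Q ->]]|[P [Q ->]]]; last first.
  exists (col_mx P 0), (row_mx Q 0).
  by rewrite !mul_row_col !mulmx0 mul0mx !addr0.
have [/(qrank_row_mxP A)[N' ->] /(qrank_col_mxP C)[K' ->]] := (rA, rC).
exists (usubmx P + N' *m dsubmx P), (lsubmx Q + rsubmx Q *m K').
rewrite -{1}[P]vsubmxK -{1}[Q]hsubmxK !mul_row_col.
by rewrite mulmxDr mulmxDl !mulmxA.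
Qed.
End LinearAlgebra.

(** * Solution of the system *)

Theorem theorem3p2 (R : realType) (m n k l : nat)
    (A : 'M[dual (quat R)]_(m, n)) (B : 'M[dual (quat R)]_(m, k))
    (C : 'M[dual (quat R)]_(k, l)) (D : 'M[dual (quat R)]_(n, l)) :
  let A0 := stdmx A in let A1 := infmx A in
  let B0 := stdmx B in let B1 := infmx B in
  let C0 := stdmx C in let C1 := infmx C in
  let D0 := stdmx D in let D1 := infmx D in
  let B11 := B1 - A1 *m (mpinv A0 *m B0 + Lmx A0 *m D0 *m mpinv C0) in
  let D11 := D1 - (mpinv A0 *m B0 + Lmx A0 *m D0 *m mpinv C0) *m C1 in
  let A11 := A1 *m Lmx A0 in
  let C11 := Rmx C0 *m C1 in
  let A2 := Rmx A0 *m A11 in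
  let B2 := Rmx C0 in
  let C2 := Rmx A0 *m B11 in
  let A3 := Lmx A0 in
  let B3 := C11 *m Lmx C0 in
  let C3 := D11 *m Lmx C0 in
  let A00 := A3 *m Lmx A2 in
  let B00 := Rmx B2 *m B3 in
  let C00 := C3 - A3 *m mpinv A2 *m C2 *m mpinv B2 *m B3 in
  let D00 := Rmx A00 *m A3 in
  let Phi := mpinv A2 *m C2 *m mpinv B2
             + Lmx A2 *m mpinv A00 *m C00 *m mpinv B3
             - Lmx A2 *m mpinv A00 *m A3 *m mpinv D00 *m Rmx A00 *m C00
                 *m mpinv B3
             + mpinv D00 *m Rmx A00 *m C00 *m mpinv B00 *m Rmx B2 in
  let sol (X : 'M[dual (quat R)]_(n, k)) := A *m X = B /\ X *m C = D in
  let consistent := exists X, sol X in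
  let compatible :=
    A0 *m D0 = B0 *m C0 /\
    A0 *m D1 - B0 *m C1 = B1 *m C0 - A1 *m D0 in
  let projector_conditions :=
    [/\ Rmx A0 *m B0 = 0, D0 *m Lmx C0 = 0 & compatible] /\
    [/\ Rmx A2 *m C2 = 0, C2 *m Lmx B2 = 0, Rmx A3 *m C3 = 0,
        C3 *m Lmx B3 = 0 & Rmx A00 *m C00 *m Lmx B00 = 0] in
  let rank_conditions :=
    compatible /\
    [/\ qrank (row_mx A0 B0) = qrank A0,
        qrank (col_mx C0 D0) = qrank C0,
        qrank (col_mx (row_mx A0 (row_mx B1 A1))
                      (row_mx 0 (row_mx B0 A0)))
          = qrank (block_mx A0 A1 0 A0) &
        qrank (row_mx A0 (A1 *m D0 - B1 *m C0)) = qrank A0] /\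
    [/\ qrank (col_mx C0 (B0 *m C1 - A0 *m D1)) = qrank C0,
        qrank (col_mx (row_mx C0 0) (col_mx (row_mx D1 D0) (row_mx C1 C0)))
          = qrank (block_mx C0 0 C1 C0) &
        qrank (col_mx (row_mx (B1 *m C1 - A1 *m D1)
                              (row_mx A0 (B1 *m C0 - A1 *m D0)))
              (col_mx (row_mx C0 (row_mx 0 0))
                      (row_mx (B0 *m C1 - A0 *m D1) (row_mx 0 0))))
          = (qrank A0 + qrank C0)%N] in
  let U (U2 U3 U4 U5 : 'M[quat R]_(n, k)) :=
    Phi + Lmx A2 *m Lmx A00 *m U2 + U3 *m Rmx B00 *m Rmx B2
        + Lmx A2 *m U4 *m Rmx B3 + Lmx A3 *m U5 *m Rmx B2 in
  let X0 (V : 'M[quat R]_(n, k)) :=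
    mpinv A0 *m B0 + Lmx A0 *m D0 *m mpinv C0 + Lmx A0 *m V *m Rmx C0 in
  let X1 (V U1 : 'M[quat R]_(n, k)) :=
    mpinv A0 *m (B11 - A11 *m V *m Rmx C0)
    + Lmx A0 *m (D11 - Lmx A0 *m V *m C11) *m mpinv C0
    + Lmx A0 *m U1 *m Rmx C0 in
  [/\ consistent <-> projector_conditions,
      consistent <-> rank_conditions &
      consistent -> forall X, sol X <->
        exists U1 U2 U3 U4 U5 : 'M[quat R]_(n, k),
          X = dualmx (X0 (U U2 U3 U4 U5)) (X1 (U U2 U3 U4 U5) U1)].
Proof.
move=> A0 A1 B0 B1 C0 C1 D0 D1 B11 D11 A11 C11 A2 B2 C2 A3 B3 C3.
move=> A00 B00 C00 D00 Phi sol consistent compatible projector_conditions.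
move=> rank_conditions U X0 X1.
have RB0 : B00 = 0 by rewrite /B00 /B3 /C11 !mulmxA Rmx_mulmx !mul0mx.
have UP V := @eq_two_sidedP R m n n k k l A2 B2 C2 A3 B3 C3 V RB0.
have RE V : Rmx A0 *m (B11 - A11 *m V *m Rmx C0) = C2 - A2 *m V *m B2.
  by rewrite mulmxBr /C2 /A2 /B2 /A11 !mulmxA.
have FL V : (D11 - Lmx A0 *m V *m C11) *m Lmx C0 = C3 - A3 *m V *m B3.
  by rewrite mulmxBl /C3 /A3 /B3 /C11 !mulmxA.
have E V : B1 - A1 *m X0 V = B11 - A11 *m V *m Rmx C0.
  by rewrite /X0 mulmxDr opprD addrA /A11 !mulmxA.
have F V : D1 - X0 V *m C1 = D11 - Lmx A0 *m V *m C11.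
  by rewrite /X0 mulmxDl opprD addrA /C11 !mulmxA.
(* The two systems over the quaternions, with X0 on the right of the second. *)
have solE X : sol X <->
    (A0 *m stdmx X = B0 /\ stdmx X *m C0 = D0) /\
    (A0 *m infmx X = B1 - A1 *m stdmx X /\ infmx X *m C0 = D1 - stdmx X *m C1).
  split=> [[/dual_mulmxP[AX AX1] /dual_mulmxP[XC XC1]]|[[AX XC] [AX1 XC1]]].
    by rewrite /B1 /D1 -AX1 -XC1 addrK [_ + infmx X *m _]addrC addrK.
  split; apply/dual_mulmxP; split=> //; first by rewrite AX1 subrK.
  by rewrite XC1 addrC subrK.
(* Each system is solved by [eq_pairP]; RE and FL turn the solvability of the
   second one into the two equations on V. *)
have solP X : sol X <->
    [/\ Rmx A0 *m B0 = 0, D0 *m Lmx C0 = 0 & compatible] /\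
    exists V U1, [/\ A2 *m V *m B2 = C2, A3 *m V *m B3 = C3,
                    stdmx X = X0 V & infmx X = X1 V U1].
  have compE : A0 *m stdmx X = B0 -> stdmx X *m C0 = D0 ->
      A0 *m (D1 - stdmx X *m C1) = (B1 - A1 *m stdmx X) *m C0 <->
      A0 *m D1 - B0 *m C1 = B1 *m C0 - A1 *m D0.
    by move=> AX XC; rewrite mulmxBr mulmxBl mulmxA AX -mulmxA XC.
  apply: iff_trans (solE X) _; split.
    move=> [e0 e1]; have [AX XC] := e0.
    have [[RB DL AD] [V eV]] := (eq_pairP _ _ _ _ _).1 e0.
    have [[e2 e3 /(compE AX XC) comp] [U1 eU]] := (eq_pairP _ _ _ _ _).1 e1.
    split; first by split.
    exists V, U1; move: e2 e3 eU; rewrite eV E F RE FL.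
    by move=> /eqP + /eqP + eU; rewrite !subr_eq0 => /eqP e2 /eqP e3; split.
  move=> [[RB DL [AD comp]] [V [U1 [e2 e3 eV eU]]]].
  have e0 : A0 *m stdmx X = B0 /\ stdmx X *m C0 = D0.
    by apply/eq_pairP; split=> //; exists V.
  split=> //; apply/eq_pairP; split; last by exists U1; rewrite eV E F.
  split; last by case: e0 => AX XC; apply/compE.
    by rewrite eV E RE e2 subrr.
  by rewrite eV F FL e3 subrr.
have part1 : consistent <-> projector_conditions.
  split=> [[X /solP[Z [V [U1 [e2 e3 _ _]]]]]|[Z cond]].
    exact: conj Z ((UP V).1 (conj e2 e3)).1.
  pose V := U 0 0 0 0.
  have [e2 e3] : A2 *m V *m B2 = C2 /\ A3 *m V *m B3 = C3.
    by apply/UP; split=> //; exists 0, 0, 0, 0.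
  exists (dualmx (X0 V) (X1 V 0)); apply/solP; split=> //.
  by exists V, 0; rewrite stdmx_dualmx infmx_dualmx.
split=> //; last first.
  move=> /part1[Z cond] X; split.
    move=> /solP[_ [V [U1 [e2 e3 eV eU]]]].
    have [_ [U2 [U3 [U4 [U5 eVU]]]]] := (UP V).1 (conj e2 e3).
    by exists U1, U2, U3, U4, U5; rewrite -[X]dualmxE eU eV eVU.
  move=> [U1 [U2 [U3 [U4 [U5 ->]]]]]; apply/solP; split=> //.
  exists (U U2 U3 U4 U5), U1; rewrite stdmx_dualmx infmx_dualmx.
  have [e2 e3] // : A2 *m U U2 U3 U4 U5 *m B2 = C2 /\
                    A3 *m U U2 U3 U4 U5 *m B3 = C3.
  by apply/UP; split=> //; exists U2, U3, U4, U5.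
split=> [[X solX]|[comp [[r1 r2 r3 r4] [r5 r6 r7]]]].
  have /solP[[_ _ comp] _] := solX; have [e0 e1] := comp.
  have [/dual_mulmxP[AX0 AX1] /dual_mulmxP[XC0 XC1]] := solX.
  have rN : qrank (row_mx A0 (B1 *m C0 - A1 *m D0)) = qrank A0.
    apply/qrank_row_mxP; exists (D1 - stdmx X *m C1).
    by rewrite mulmxBr mulmxA AX0 e1.
  have rK : qrank (col_mx C0 (B0 *m C1 - A0 *m D1)) = qrank C0.
    apply/qrank_col_mxP; exists (A1 *m stdmx X - B1).
    by rewrite mulmxBl -mulmxA XC0 -opprB e1 opprB.
  split; first exact: comp.
  split; split.
  - by apply/qrank_row_mxP; exists (stdmx X).
  - by apply/qrank_col_mxP; exists (stdmx X).
  - by apply/qrank_dual_colsP; exists (stdmx X), (infmx X).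
  - apply/qrank_row_mxP; exists (stdmx X *m C1 - D1).
    by rewrite -opprB -e1 mulmxBr mulmxA AX0 opprB.
  - exact: rK.
  - by apply/qrank_dual_rowsP; exists (stdmx X), (infmx X).
  apply/qrank_corner0P => //; exists (infmx X *m C1), (- (A1 *m infmx X)).
  rewrite /B1 /D1 -AX1 -XC1 mulmxDl mulmxDr !mulmxA opprD addrA addrK.
  by rewrite mulNmx.
(* The solution of the first system with V = 0 serves as origin: B11 and D11 are
   the right-hand sides of the second system at that point. *)
apply/part1; have [e0 e1] := comp.
have /(qrank_row_mxP A0)[Y0 eY0] := r1.
have /(qrank_col_mxP C0)[Z0 eZ0] := r2.
have RB : Rmx A0 *m B0 = 0 by rewrite eY0 mulmxA Rmx_mulmx mul0mx.
have DL : D0 *m Lmx C0 = 0 by rewrite eZ0 mulmx_LmxK.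
have [Ax xC] : A0 *m X0 0 = B0 /\ X0 0 *m C0 = D0.
  by apply/eq_pairP; split=> //; exists 0.
have B11E : B11 = B1 - A1 *m X0 0 by rewrite E mulmx0 mul0mx subr0.
have D11E : D11 = D1 - X0 0 *m C1 by rewrite F mulmx0 mul0mx subr0.
have B11C0 : B11 *m C0 = A0 *m D1 - B0 *m C1.
  by rewrite B11E mulmxBl -(mulmxA A1) xC e1.
have A0D11 : A0 *m D11 = A0 *m D1 - B0 *m C1.
  by rewrite D11E mulmxBr mulmxA Ax.
have C2B2 : C2 *m B2 = C2.
  apply: Rmx_id; rewrite /C2 -mulmxA B11C0 mulmxBr !mulmxA Rmx_mulmx RB.
  by rewrite !mul0mx subr0.
have LC3 : Lmx A0 *m C3 = C3.
  apply: Lmx_id; rewrite /C3 mulmxA A0D11 e1 mulmxBl mulmx_LmxK.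
  by rewrite -mulmxA DL mulmx0 subr0.
have CL2 : C2 *m Lmx B2 = 0 by rewrite -C2B2 mulmx_LmxK.
(* A1 D11 - B11 C1 equals A1 D1 - B1 C1, because the terms A1 (X0 0) C1 cancel,
   and the last rank equality says that R_{A0} and L_{C0} annihilate it. *)
have A2C3 : A2 *m C3 = C2 *m B3.
  have rN : qrank (row_mx A0 (B1 *m C0 - A1 *m D0)) = qrank A0.
    by apply/qrank_row_mxP; exists D11; rewrite A0D11 e1.
  have [P [Q eM]] := (qrank_corner0P _ rN r5).1 r7.
  have A1D11 : A1 *m D11 - B11 *m C1 = - (A0 *m P + Q *m C0).
    rewrite -eM D11E B11E mulmxBr mulmxBl mulmxA.
    move: (A1 *m D1) (A1 *m X0 0 *m C1) (B1 *m C1) => M1 M2 M3.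
    by rewrite !opprB addrA subrK.
  have RPQL : Rmx A0 *m (A0 *m P + Q *m C0) *m Lmx C0 = 0.
    have -> : Rmx A0 *m (A0 *m P + Q *m C0) = Rmx A0 *m Q *m C0.
      by rewrite mulmxDr !mulmxA Rmx_mulmx mul0mx add0r.
    exact: mulmx_LmxK.
  have -> : A2 *m C3 = Rmx A0 *m A1 *m D11 *m Lmx C0.
    by rewrite /A2 /A11 -!mulmxA LC3 /C3.
  have -> : C2 *m B3 = Rmx A0 *m B11 *m C1 *m Lmx C0.
    by rewrite /B3 /C11 -/B2 !(mulmxA C2) C2B2.
  apply/eqP; rewrite -subr_eq0 -mulmxBl -(mulmxA _ A1) -(mulmxA _ B11) -mulmxBr.
  by rewrite A1D11 mulmxN mulNmx RPQL oppr0.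
have C2B3 : C2 *m mpinv B2 *m B3 = A2 *m C3.
  by rewrite A2C3 /B3 /C11 -/B2 !mulmxA ((Lmx_eq0 _ _).1 CL2) C2B2.
have C00E : C00 = A00 *m C3.
  have L2C3 : Lmx A2 *m C3 = C3 - mpinv A2 *m (A2 *m C3).
    by rewrite LmxE mulmxBl mul1mx mulmxA.
  rewrite /C00 -2!(mulmxA (A3 *m mpinv A2)) C2B3 /A00 -[RHS]mulmxA L2C3.
  by rewrite mulmxBr LC3 !mulmxA.
split; first by split.
split.
(* A solution Z of the standard part of A X = B differs from X0 0 by a matrix
   killed by A0, and this difference solves A2 Y = C2. *)
- have [Z [W [AZ AW]]] := (qrank_dual_colsP _ _ _ _).1 r3.
  have AZx : A0 *m (Z - X0 0) = 0 by rewrite mulmxBr AZ Ax subrr.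
  have -> : C2 = A2 *m (Z - X0 0).
    have -> : C2 = Rmx A0 *m (A1 *m (Z - X0 0)).
      rewrite /C2 B11E -AW -addrA -mulmxBr.
      by rewrite (mulmxDr _ (A0 *m W)) mulmxA Rmx_mulmx mul0mx add0r.
    by rewrite -[in LHS](Lmx_id AZx) /A2 /A11 !mulmxA.
  by rewrite mulmxA Rmx_mulmx mul0mx.
- exact: CL2.
- by rewrite -LC3 mulmxA Rmx_mulmx mul0mx.
- have [Z [W [ZC WC]]] := (qrank_dual_rowsP _ _ _ _).1 r6.
  have ZxC : (Z - X0 0) *m C0 = 0 by rewrite mulmxBl ZC xC subrr.
  have -> : C3 = (Z - X0 0) *m B3.
    rewrite /C3 D11E -WC addrAC -mulmxBl (mulmxDl _ (W *m C0)) mulmx_LmxK addr0.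
    by rewrite -[in LHS](Rmx_id ZxC) /B3 /C11 !mulmxA.
  exact: mulmx_LmxK.
- by rewrite C00E mulmxA Rmx_mulmx !mul0mx.
Qed.
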